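(* Let $M$ be a complete pointed metric space which is a length space, and let $X$ be a Banach space. Then the Banach space $\mathrm{Lip}_0(M,X)$ has the Daugavet property. *)

(* Defs.v *)
From HB Require Import structures.
From mathcomp Require Import all_boot all_order all_algebra.
From mathcomp Require Import all_classical all_reals all_analysis.
Set Implicit Arguments. Unset Strict Implicit. Unset Printing Implicit Defensive.
Import Order.TTheory GRing.Theory Num.Theory.
Import numFieldNormedType.Exports.
Local Open Scope classical_set_scope.
Local Open Scope ring_scope.

Section Defs.
Variable R : realType.

Definition is_metric (M : Type) (d : M -> M -> R) : Prop :=
  (forall x y, d x y = 0 <-> x = y) /\
  (forall x y, d x y = d y x) /\
  (forall x y z, d x z <= d x y + d y z).

Definition complete_metric (M : Type) (d : M -> M -> R) : Prop :=
  forall u : nat -> M,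
    (forall e : R, 0 < e -> exists N : nat, forall m n : nat,
        (N <= m)%N -> (N <= n)%N -> d (u m) (u n) < e) ->
    exists l : M, forall e : R, 0 < e -> exists N : nat, forall n : nat,
        (N <= n)%N -> d (u n) l < e.

Definition continuous_curve (M : Type) (d : M -> M -> R) (g : R -> M) : Prop :=
  forall t, 0 <= t <= 1 -> forall e : R, 0 < e -> exists2 delta : R, 0 < delta &
    forall s, 0 <= s <= 1 -> `|s - t| < delta -> d (g s) (g t) < e.

Definition partition_sum (M : Type) (d : M -> M -> R) (g : R -> M) (s : seq R) : R :=
  \sum_(i < (size s).-1) d (g s`_i) (g s`_i.+1).

Definition curve_length_le (M : Type) (d : M -> M -> R) (g : R -> M) (L : R) : Prop :=
  forall s : seq R, sorted <=%R s -> all (fun t => 0 <= t <= 1) s ->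
    partition_sum d g s <= L.

Definition length_space (M : Type) (d : M -> M -> R) : Prop :=
  forall x y : M, forall e : R, 0 < e ->
    exists g : R -> M, [/\ continuous_curve d g, g 0 = x, g 1 = y &
                          curve_length_le d g (d x y + e)].

Variable X : completeNormedModType R.

Definition is_lip0 (M : Type) (d : M -> M -> R) (x0 : M) (f : M -> X) : Prop :=
  f x0 = 0 /\ exists C : R, forall x y, `|f x - f y| <= C * d x y.

Definition lipnorm (M : Type) (d : M -> M -> R) (f : M -> X) : R :=
  sup [set r : R | exists x y : M, x <> y /\ r = `|f x - f y| / d x y].

(** bounded linear operators on Lip_0(M,X) (represented by maps on M -> X,
    only their behaviour on Lip_0 functions matters) *)
Definition lip0_bounded_op (M : Type) (d : M -> M -> R) (x0 : M)
    (T : (M -> X) -> (M -> X)) : Prop :=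
  [/\ forall f, is_lip0 d x0 f -> is_lip0 d x0 (T f),
      forall f g, is_lip0 d x0 f -> is_lip0 d x0 g -> T (f \+ g) = T f \+ T g,
      forall (a : R) f, is_lip0 d x0 f -> T (fun x => a *: f x) = (fun x => a *: T f x)
    & exists C : R, forall f, is_lip0 d x0 f -> lipnorm d (T f) <= C * lipnorm d f].

Definition lip0_opnorm (M : Type) (d : M -> M -> R) (x0 : M)
    (T : (M -> X) -> (M -> X)) : R :=
  sup [set r : R | exists f : M -> X,
         [/\ is_lip0 d x0 f, lipnorm d f <= 1 & r = lipnorm d (T f)]].

Definition lip0_rank_one (M : Type) (d : M -> M -> R) (x0 : M)
    (T : (M -> X) -> (M -> X)) : Prop :=
  [/\ lip0_bounded_op d x0 T,
      exists g : M -> X, forall f, is_lip0 d x0 f -> exists c : R, T f = (fun x => c *: g x)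
    & exists f, is_lip0 d x0 f /\ T f <> (fun _ => 0)].

Definition lip0_daugavet (M : Type) (d : M -> M -> R) (x0 : M) : Prop :=
  forall T : (M -> X) -> (M -> X), lip0_rank_one d x0 T ->
    lip0_opnorm d x0 (fun f => f \+ T f) = 1 + lip0_opnorm d x0 T.

End Defs.

(* Main.v *)
(* Let w = T f with f in the unit ball and w of almost maximal norm.  We look for
   F of norm at most 1 + 2 eps with T F close to w and |F + w| close to
   1 + |w|.

   Points u, v at tiny distance at which w has almost its full slope exist in
   many places, separated by a distance that does not depend on how close u and
   v are.  Around each of them f can be flattened to the constant f(u) by a
   logarithmic cutoff, which costs only a factor 1 + eps in the Lipschitz
   constant and needs no extension theorem in X; a tent of slope 1 in the
   direction of w(u) - w(v) is then added at a much smaller scale.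

   The n modifications F_i so obtained differ from f on disjoint balls, hence
   signed sums of the F_i - f keep a Lipschitz constant independent of n.  As T
   has rank one, T (F_i - f) = O(1/n) for some i. *)
Require Import Defs.
From HB Require Import structures.
From mathcomp Require Import all_boot all_order all_algebra.
From mathcomp Require Import all_classical all_reals all_analysis.
From mathcomp Require Import zify ring lra.
Set Implicit Arguments. Unset Strict Implicit. Unset Printing Implicit Defensive.
Import Order.TTheory GRing.Theory Num.Theory.
Import numFieldNormedType.Exports.
Local Open Scope ring_scope.

(** * Almost geodesic chains in a length space *)

(** Only a zero diagonal and the triangle inequality are assumed, so that the bound also applies to
    the pseudometric [|w s - w t|]. *)
Lemma chain_le (R : realType) (M : Type) (d : M -> M -> R)
    (z : nat -> M) (l : R) i j :
  (forall x, d x x = 0) -> (forall x y t, d x t <= d x y + d y t) ->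
  (i <= j)%N -> (forall k, (i <= k < j)%N -> d (z k) (z k.+1) <= l) ->
  d (z i) (z j) <= (j - i)%:R * l.
Proof.
move=> d0 dD ij; elim: j ij => [|j IH] ij h.
  by move: ij; rewrite leqn0 => /eqP->; rewrite d0 mul0r.
have [->|ij'] := eqVneq i j.+1; first by rewrite subnn mul0r d0.
have {}ij : (i <= j)%N by lia.
rewrite subSn // -natr1 mulrDl mul1r.
apply: le_trans (dD _ (z j) _) _; apply: lerD.
  by apply: IH => // k kj; apply: h; lia.
by apply: h; rewrite ij /=.
Qed.

Section Metric.
Local Open Scope classical_set_scope.
Local Open Scope ring_scope.
Variables (R : realType) (M : Type) (d : M -> M -> R).
Hypothesis dM : is_metric d.

Lemma distxx x : d x x = 0.
Proof. by case: dM => h _; apply/h. Qed.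

Lemma distC x y : d x y = d y x.
Proof. by case: dM => _ []. Qed.

Lemma dist_triangle y x z : d x z <= d x y + d y z.
Proof. by case: dM => _ [_]; exact. Qed.

Lemma dist_ge0 x y : 0 <= d x y.
Proof.
have := dist_triangle y x x; rewrite distxx (distC y x); lra.
Qed.

Lemma dist_gt0 x y : x <> y -> 0 < d x y.
Proof.
move=> xy; rewrite lt_neqAle dist_ge0 andbT; apply/eqP => /esym.
by case: dM => h _ /h.
Qed.

(** The intermediate value theorem finds, on an almost shortest curve, a point equidistant from [x]
    and [y]; the partition [0, t, 1] bounds the sum of its two distances. *)
Lemma near_midpoint : length_space d -> forall x y e, 0 < e ->
  exists m, d x m <= (d x y + e) / 2 /\ d m y <= (d x y + e) / 2.
Proof.
move=> lM x y e e0; have [g [gC g0 g1 gL]] := lM x y e e0.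
pose phi t := d x (g t) - d (g t) y.
have phiC : {within `[0, 1]%classic, continuous phi}.
  apply/subspace_continuousP => t /=; rewrite in_itv /= => t01.
  apply/cvgrPdist_lt => e' e'0.
  have e'2 : 0 < e' / 2 by lra.
  have [del del0 gt] := gC t t01 _ e'2.
  rewrite near_withinE.
  have := nbhsx_ballx t del del0; apply: filterS => s ts /=.
  rewrite in_itv /= => s01.
  have gst : d (g s) (g t) < e' / 2 by apply: gt; rewrite // distrC.
  suff : `|phi t - phi s| < e' by [].
  apply/ltr_normlP; rewrite /phi.
  have := dist_triangle (g s) x (g t); have := dist_triangle (g t) x (g s).
  have := dist_triangle (g s) (g t) y; have := dist_triangle (g t) (g s) y.
  by rewrite (distC (g t) (g s)); split; lra.
have [] := @IVT R phi 0 1 0 ler01 phiC.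
  rewrite /phi g0 g1 !distxx sub0r subr0 ge_min le_max.
  by have := dist_ge0 x y; lra.
move=> t; rewrite in_itv /= => t01 phit; exists (g t).
have := gL [:: 0; t; 1]; rewrite /partition_sum /= !big_ord_recl big_ord0 /=.
rewrite g0 g1 addr0 !lexx ler01 (andP t01).1 (andP t01).2 => /(_ isT isT).
by move: phit; rewrite /phi; lra.
Qed.

(** Repeated bisection: of the slack [e], [e / 2] is allowed for the midpoint and [e / 4] for each
    of the two halves. *)
Lemma near_geodesic_chain : length_space d -> forall k x y e, 0 < e ->
  exists z : nat -> M, [/\ z 0%N = x, z (2 ^ k)%N = y &
    forall i, (i < 2 ^ k)%N -> d (z i) (z i.+1) <= (d x y + e) / 2 ^+ k].
Proof.
move=> lM; elim=> [|k IH] x y e e0.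
  exists (fun i => if i is 0%N then x else y); split => //= -[|i] //= _.
  by rewrite expr0; lra.
have e2 : 0 < e / 2 by lra.
have e4 : 0 < e / 4 by lra.
have [m [xm my]] := near_midpoint lM x y e2.
have [z1 [z10 z1m z1P]] := IH x m _ e4.
have [z2 [z20 z2y z2P]] := IH m y _ e4.
have k0 : (0 < 2 ^ k)%N by rewrite expn_gt0.
have shrink a : a <= (d x y + e / 2) / 2 ->
    (a + e / 4) / 2 ^+ k <= (d x y + e) / 2 ^+ k.+1.
  move=> h; rewrite exprS invfM mulrA ler_wpM2r ?invr_ge0 ?exprn_ge0 //; lra.
exists (fun i => if (i < 2 ^ k)%N then z1 i else z2 (i - 2 ^ k)%N); split.
- by rewrite k0.
- rewrite expnS ifF ?mul2n -?addnn ?addnK //.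
  by apply/negbTE; rewrite -leqNgt leq_addl.
move=> i; rewrite expnS => ik.
have [i1|i1] := ltnP i (2 ^ k).
  apply: le_trans (shrink _ xm); have [i2|i2] := ltnP i.+1 (2 ^ k).
    exact: z1P.
  have Ei : i.+1 = (2 ^ k)%N by lia.
  by have := z1P i i1; rewrite Ei subnn z20 z1m.
rewrite ifF; last by apply/negbTE; rewrite -leqNgt; lia.
rewrite subSn //; apply: le_trans (z2P _ _) (shrink _ my).
by rewrite ltn_subLR // addnn -mul2n.
Qed.

Lemma half_block_le m n j : (j < m)%N -> (j * (2 * n) + n <= m * (2 * n))%N.
Proof.
move=> jm; apply: leq_trans (leq_mul jm (leqnn _)).
by rewrite (mulSn j) addnC leq_add2r mul2n -addnn leq_addr.
Qed.

(* Along an almost geodesic chain with [2 ^ (p + q + 1)] links, the position of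
   a point is nearly determined by its index.  So links taken from the first
   halves of the [2 ^ p] blocks of [2 ^ (q + 1)] links start at points whose
   separation does not depend on [q], while their length tends to 0. *)
Lemma steep_links (V : normedModType R) (w : M -> V) (W : R) :
  length_space d -> 0 < W -> (forall x y, `|w x - w y| <= W * d x y) ->
  (forall k, 0 < k -> exists x y,
     0 < d x y /\ (1 - k) * W * d x y < `|w x - w y|) ->
  forall p eps, 0 < eps <= 1 -> exists2 r, 0 < r &
  forall eta, 0 < eta -> exists u v : nat -> M,
  forall i, (i < 2 ^ p)%N -> [/\ 0 < d (u i) (v i) <= eta,
    (1 - eps) * W * d (u i) (v i) <= `|w (u i) - w (v i)| &
    forall j, (j < 2 ^ p)%N -> i != j -> 2 * r <= d (u i) (u j)].
Proof.
move=> lM W0 wW wS p eps /andP[eps0 eps1].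
pose P : R := 2 ^+ p.
have P1 : 1 <= P by rewrite exprn_ege1 // ler1n.
have P0 : 0 < P by lra.
(* If the first half of a block had no steep link, [w] would lose at least [eps * W * (D + e) / (2 *
   P) = 2 * kap * W * (D + e)] there. This exceeds the total slack: [kap * W * D] in the choice of
   [x], [y], and [W * e = kap * W * D] from the excess length of the chain. *)
pose kap := eps / (4 * P).
have kap0 : 0 < kap by rewrite divr_gt0 // mulr_gt0.
have kapE : eps = 4 * P * kap by rewrite /kap mulrC divfK // gt_eqF // mulr_gt0.
have [x [y [D0 xyS]]] := wS _ kap0; set D := d x y in D0 xyS.
(* The radius is fixed before [eta], hence independently of the number and length of the links. *)
exists (D / (8 * P)) => [|eta eta0]; first by rewrite divr_gt0 // mulr_gt0.
pose e := kap * D.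
have e0 : 0 < e by rewrite mulr_gt0.
have [q qP] : exists q, (D + e) / eta < q%:R.
  exists (Num.bound ((D + e) / eta)); apply: archi_boundP.
  by rewrite ltW // divr_gt0 // addr_gt0.
pose k := (p + q.+1)%N.
have [z [z0 zk zP]] := near_geodesic_chain lM k x y e0.
rewrite -/D in zP; set l := (D + e) / 2 ^+ k in zP.
pose Q : R := 2 ^+ q.
have Q0 : 0 < Q by rewrite exprn_gt0.
have kE : 2 ^+ k = 2 * P * Q :> R by rewrite /k exprD exprS /P /Q; ring.
have lE : 2 * P * Q * l = D + e.
  by rewrite /l kE mulrC divfK // gt_eqF // !mulr_gt0.
have l0 : 0 < l by rewrite divr_gt0 // ?exprn_gt0 // addr_gt0.
have leta : l <= eta.
  rewrite ler_pdivrMr ?exprn_gt0 // mulrC -ler_pdivrMr // kE.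
  have : q%:R <= Q by rewrite /Q -natrX ler_nat ltnW // ltn_expl.
  by nra.
have knat : (2 ^ k = 2 ^ p * (2 * 2 ^ q))%N by rewrite /k expnD expnS.
have q0 : (0 < 2 ^ q)%N by rewrite expn_gt0.
have dchain i j : (i <= j <= 2 ^ k)%N -> d (z i) (z j) <= (j - i)%:R * l.
  move=> /andP[ij jk]; apply: (@chain_le _ _ d) => //; first exact: distxx.
    by move=> ???; apply: dist_triangle.
  by move=> h /andP[_ hj]; apply/zP/(leq_trans hj).
(* The pieces from [x] to [z i] and from [z j] to [y] are short because the links have total length
   at most [D + e]. Half a block of indices thus leaves a distance of at least [Q * l - e], where
   [Q * l >= D / (2 * P)] and [e <= D / (4 * P)]. *)
have sep i j : (i + 2 ^ q <= j <= 2 ^ k)%N ->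
    2 * (D / (8 * P)) <= d (z i) (z j).
  move=> /andP[ij jk].
  have h1 := dchain 0%N i (leq_trans (leq_trans (leq_addr _ _) ij) jk).
  have := dchain j (2 ^ k)%N; rewrite jk leqnn => /(_ isT) h2.
  have := dist_triangle (z i) x y; have := dist_triangle (z j) (z i) y.
  rewrite -/D -{1}z0 -{1}zk; move: h1 h2; rewrite z0 zk subn0 natrB //.
  rewrite natrX kE => h1 h2 h3 h4.
  have : i%:R + Q <= j%:R :> R by rewrite /Q -natrX -natrD ler_nat.
  have -> : D / (8 * P) = D / P / 8 by field; rewrite gt_eqF.
  have DPE : D / P * P = D by rewrite divfK // gt_eqF.
  have DP0 : 0 < D / P by rewrite divr_gt0.
  have : e <= D / P / 4.
    rewrite /e /kap -subr_ge0.
    have -> : D / P / 4 - eps / (4 * P) * D = (1 - eps) * (D / P) / 4.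
      by field; rewrite gt_eqF.
    by rewrite divr_ge0 // mulr_ge0 ?subr_ge0 // ltW.
  have : D / P / 2 <= Q * l.
    have -> : Q * l = (D + e) / P / 2 by rewrite -lE; field; rewrite gt_eqF.
    by rewrite ler_pM2r // ler_pM2r ?invr_gt0 //; lra.
  by nra.
(* Otherwise [w] varies by at most [(1 - eps) * W * l] along each link of the first half of block
   [j], and summing along the chain contradicts [xyS]. The bound on [j] stands under the existential
   so that [choice] yields a function on all indices. *)
have steep j : exists i, (j < 2 ^ p)%N ->
    (j * (2 * 2 ^ q) <= i < j * (2 * 2 ^ q) + 2 ^ q)%N /\
    (1 - eps) * W * l < `|w (z i) - w (z i.+1)|.
  have [jp|jp] := boolP (j < 2 ^ p)%N; last by exists 0%N.
  apply: contrapT => /forallNP none.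
  pose a := (j * (2 * 2 ^ q))%N; pose b := (a + 2 ^ q)%N.
  have bk : (b <= 2 ^ k)%N by rewrite /b /a knat half_block_le.
  have mid : `|w (z a) - w (z b)| <= (b - a)%:R * ((1 - eps) * W * l).
    apply: (@chain_le _ _ (fun s t => `|w s - w t|)) => [s|s t t'||i ib].
    - by rewrite subrr normr0.
    - by rewrite -(subrKA (w t)) ler_normD.
    - exact: leq_addr.
    - by rewrite leNgt; apply/negP => iS; apply: (none i).
  have ak : (a <= 2 ^ k)%N := leq_trans (leq_addr _ _) bk.
  have h1 := le_trans (wW (z 0%N) (z a))
    (ler_wpM2l (ltW W0) (dchain 0%N a ak)).
  have h2 := le_trans (wW (z b) (z (2 ^ k)%N))
    (ler_wpM2l (ltW W0) (dchain b (2 ^ k)%N (introT andP (conj bk (leqnn _))))).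
  have : `|w x - w y| <=
      `|w x - w (z a)| + `|w (z a) - w (z b)| + `|w (z b) - w y|.
    rewrite -(subrKA (w (z b)) (w x)); apply: le_trans (ler_normD _ _) _.
    by rewrite lerD2r -(subrKA (w (z a))) ler_normD.
  move: h1 h2 mid; rewrite z0 zk subn0 natrB // /b addKn natrD !natrX kE -/Q.
  move=> h1 h2 mid h.
  have : `|w x - w y| <= W * (D + e) - eps * Q * W * l.
    by rewrite -lE; lra.
  have -> : eps * Q * W * l = 2 * kap * W * (D + e) by rewrite -lE kapE; ring.
  have : 0 < W * D by rewrite mulr_gt0.
  by rewrite /e; nra.
have [f fP] := choice steep.
exists (z \o f), (z \o S \o f) => i ip /=.
have [fi fS] := fP _ ip.
have fik : (f i < 2 ^ k)%N.
  by rewrite knat; case/andP: fi => _ /leq_trans; apply; exact: half_block_le.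
have dl := zP _ fik.
have leW : (1 - eps) * W * d (z (f i)) (z (f i).+1) <=
    `|w (z (f i)) - w (z (f i).+1)|.
  apply: le_trans (ltW fS); rewrite ler_wpM2l // mulr_ge0 ?subr_ge0 // ltW //.
split=> //.
  rewrite (le_trans dl) // andbT; apply: dist_gt0 => zz.
  move: fS; rewrite zz subrr normr0 ltNge => /negP; apply.
  by apply: mulr_ge0 (ltW l0); rewrite mulr_ge0 ?subr_ge0 // ltW.
have fsep i' j' : (i' < 2 ^ p)%N -> (j' < 2 ^ p)%N -> (i' < j')%N ->
    2 * (D / (8 * P)) <= d (z (f i')) (z (f j')).
  move=> ip' jp' ij; have [/andP[_ fi'] _] := fP _ ip'.
  have [/andP[fj1 fj2] _] := fP _ jp'.
  apply: sep; rewrite knat (ltnW (leq_trans fj2 (half_block_le _ jp'))) // andbT.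
  apply: leq_trans fj1; apply: leq_trans (leq_mul ij (leqnn _)).
  rewrite (mulSn i') [X in (_ <= X)%N]addnC {2}mul2n -addnn addnA leq_add2r.
  exact: ltnW.
by move=> j jp; rewrite neq_ltn => /orP[|] ij; last rewrite distC; exact: fsep.
Qed.

End Metric.

(** * The logarithmic cutoff *)

(** The rise from 0 to 1 is spread over the radii from [delta] to [delta * expR (eps^-1)], with
    slope [eps / t] at radius [t]. The convention [ln 0 = 0] gives the value 0 at the centre. *)
Definition log_cutoff (R : realType) (eps delta t : R) : R :=
  Num.min 1 (Num.max 0 (eps * ln (t / delta))).

Section LogCutoff.
Variables (R : realType) (eps delta : R).
Hypotheses (eps0 : 0 < eps) (delta0 : 0 < delta).
Local Notation theta := (log_cutoff eps delta).

Lemma log_cutoff_ge0 t : 0 <= theta t.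
Proof. by rewrite /log_cutoff le_min ler01 le_max lexx. Qed.

Lemma log_cutoff_le1 t : theta t <= 1.
Proof. by rewrite /log_cutoff ge_min lexx. Qed.

Lemma log_cutoff_eq0 t : t <= delta -> theta t = 0.
Proof.
move=> td; have : ln (t / delta) <= 0 by rewrite ln_le0 // ler_pdivrMr // mul1r.
rewrite -(pmulr_rle0 _ eps0) => h.
by rewrite /log_cutoff (max_idPl h) (min_idPr _) // ler01.
Qed.

Lemma log_cutoff_eq1 t : delta * expR (eps^-1) <= t -> theta t = 1.
Proof.
move=> td.
have h : 1 <= eps * ln (t / delta).
  rewrite mulrC -ler_pdivrMr // mul1r -[leLHS]expRK ler_ln ?posrE ?expR_gt0 //.
    by rewrite ler_pdivlMr // mulrC.
  by rewrite divr_gt0 // (lt_le_trans _ td) // mulr_gt0 // expR_gt0.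
by rewrite /log_cutoff (max_idPr _) ?(le_trans ler01 h) // (min_idPl h).
Qed.

(* The logarithmic profile satisfies [s * theta' s <= eps]. *)
Lemma log_cutoff_slope s t :
  0 <= s <= t -> s * `|theta t - theta s| <= eps * (t - s).
Proof.
move=> /andP[]; rewrite le_eqVlt => /predU1P[<-|s0] st.
  by rewrite mul0r mulr_ge0 ?subr_ge0 // ltW.
have t0 := lt_le_trans s0 st.
have lnst : ln (t / delta) - ln (s / delta) <= t / s - 1.
  rewrite !ln_div ?posrE // opprB subrKA -ln_div ?posrE //.
  have := @le_ln1Dx _ (t / s - 1); rewrite subrKC; apply.
  by rewrite ltrBDr addNr divr_gt0.
have lnle : ln (s / delta) <= ln (t / delta).
  by rewrite ler_ln ?posrE ?divr_gt0 // ler_pM2r ?invr_gt0.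
have : `|theta t - theta s| <= eps * (t / s - 1).
  (* Clipping to values between 0 and 1 does not increase differences. *)
  apply: (@le_trans _ _ (eps * ln (t / delta) - eps * ln (s / delta))).
    move: lnle; rewrite -(ler_pM2l eps0) /log_cutoff.
    set a := eps * _; set b := eps * _ => ab.
    rewrite ler_norml /Num.min /Num.max.
    by do 4 case: ifPn; rewrite -?leNgt => *; apply/andP; split; lra.
  by rewrite -mulrBr ler_pM2l.
move=> /(ler_wpM2l (ltW s0)) /le_trans; apply.
by rewrite mulrCA mulrBr mulr1 mulrCA divff ?mulr1 // gt_eqF.
Qed.

End LogCutoff.

(** * Local modifications of Lipschitz maps *)

Section Perturbation.
Variables (R : realType) (M : Type) (d : M -> M -> R) (V : normedModType R).
Hypothesis dM : is_metric d.

Lemma dist_lip u x y : `|d u x - d u y| <= d x y.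
Proof.
apply/ler_normlP.
have := dist_triangle dM x u y; have := dist_triangle dM y u x.
by rewrite (distC dM y x); split; lra.
Qed.

(** Let [x] be the point nearer to [u], and [a], [b] the cutoffs at [x], [y]. Then [F x - F y] is
    [b *: (f x - f y)] minus [(b - a) *: (f x - f u)]. Since [f x - f u] has norm at most [d u x],
    the slope bound of the cutoff makes the second term at most [eps * d x y]. *)
Lemma flatten_lip (f : M -> V) (eps delta : R) u : 0 < eps -> 0 < delta ->
  (forall x y, `|f x - f y| <= d x y) ->
  let F x := f u + log_cutoff eps delta (d u x) *: (f x - f u) in
  forall x y, `|F x - F y| <= (1 + eps) * d x y.
Proof.
move=> eps0 delta0 f1 F x y.
wlog xy : x y / d u x <= d u y => [h|].
  by have [/h//|/ltW/h] := leP (d u x) (d u y); rewrite distrC (distC dM).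
rewrite /F; set a := log_cutoff _ _ (d u x); set b := log_cutoff _ _ (d u y).
have -> : f u + a *: (f x - f u) - (f u + b *: (f y - f u)) =
          b *: (f x - f y) - (b - a) *: (f x - f u).
  have -> : f x - f y = (f x - f u) - (f y - f u) by rewrite opprB subrKA.
  move: (f x - f u) (f y - f u) => p q.
  rewrite opprD addrACA subrr add0r (scalerBr b) (scalerBl b) opprB.
  by rewrite [RHS]addrC subrKA.
rewrite mulrDl mul1r; apply: le_trans (ler_normB _ _) _; apply: lerD.
  rewrite normrZ ger0_norm ?log_cutoff_ge0 //.
  by apply: le_trans (f1 x y); rewrite ler_piMl // log_cutoff_le1.
rewrite normrZ; apply: (@le_trans _ _ (d u x * `|b - a|)).
  by rewrite mulrC ler_wpM2r // (distC dM).
apply: le_trans (log_cutoff_slope _ _ _) _ => //.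
  by rewrite dist_ge0.
rewrite ler_pM2l //; have := dist_lip u y x; rewrite (distC dM y x).
by move/ler_normlP => [_]; lra.
Qed.

(* Flatten [f] to a constant near [u] with the logarithmic cutoff, then add a
   tent of slope 1 in direction [e] on a much smaller ball. *)
Lemma local_slope_perturbation (r eps : R) : 0 < r -> 0 < eps ->
  exists2 rho0, 0 < rho0 & forall (f : M -> V) u v e,
  (forall x y, `|f x - f y| <= d x y) -> d u v <= rho0 -> `|e| = 1 ->
  exists F, [/\ forall x y, `|F x - F y| <= (1 + 2 * eps) * d x y,
    forall x, r <= d u x -> F x = f x & F u - F v = d u v *: e].
Proof.
(* With this [delta] the cutoff reaches 1 at radius [r]. *)
move=> r0 eps0; pose delta := r * expR (- eps^-1).
have delta0 : 0 < delta by rewrite mulr_gt0 ?expR_gt0.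
have deltaE : delta * expR (eps^-1) = r.
  by rewrite /delta expRN divfK // gt_eqF ?expR_gt0.
(* This bound is equivalent to [rho <= eps * (delta - rho)]: the height of the tent is at most [eps]
   times the gap between its ball and the outside of the flat ball. *)
exists (eps * delta / (1 + eps)) => [|f u v e f1 uv e1].
  by apply: divr_gt0; [exact: mulr_gt0|lra].
set rho := d u v in uv *.
have rho0 : 0 <= rho by exact: dist_ge0.
have {}uv : rho <= eps * (delta - rho).
  by move: uv; rewrite ler_pdivlMr ?addr_gt0 //; lra.
have rd : rho <= delta.
  by rewrite -subr_ge0 -(pmulr_rge0 _ eps0) (le_trans rho0 uv).
pose tent x := Num.max 0 (rho - d u x).
pose F x := f u + log_cutoff eps delta (d u x) *: (f x - f u).
have FL := @flatten_lip f eps delta u eps0 delta0 f1.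
have Fu x : d u x <= delta -> F x = f u.
  by move=> xd; rewrite /F log_cutoff_eq0 // scale0r addr0.
have tent0 x : rho <= d u x -> tent x = 0.
  by move=> h; rewrite /tent (max_idPl _) // subr_le0.
have tentu : tent u = rho by rewrite /tent distxx // subr0 (max_idPr _).
exists (fun x => F x + tent x *: e); split.
- move=> x y.
  wlog xy : x y / d u x <= d u y => [h|].
    by have [/h//|/ltW/h] := leP (d u x) (d u y); rewrite distrC (distC dM).
  have tentL : `|tent x - tent y| <= d x y.
    have /ler_normlP := dist_lip u x y; rewrite /tent => -[h1 h2].
    have := dist_ge0 dM x y; rewrite ler_norml /Num.max.
    by do 2 case: ifPn; rewrite -?leNgt => *; apply/andP; split; lra.
  have -> : F x + tent x *: e - (F y + tent y *: e) =
            (F x - F y) + (tent x - tent y) *: e.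
    by rewrite opprD addrACA scalerBl.
  have dxy := dist_ge0 dM x y.
  have [yd|yd] := leP (d u y) delta.
    rewrite !Fu ?(le_trans xy) // subrr add0r normrZ e1 mulr1.
    by apply: le_trans tentL _; rewrite ler_peMl //; lra.
  apply: le_trans (ler_normD _ _) _; rewrite normrZ e1 mulr1.
  rewrite [in leRHS]mulrDl mul1r -mulrA mulr_natl mulr2n addrA.
  have := FL x y; rewrite mulrDl mul1r => /lerD; apply.
  (* Here [y] lies outside the flat ball, so only the tent at [x] counts. If it is nonzero, then
     [d x y] is at least [delta - rho], and the tent costs at most [eps * d x y]. *)
  rewrite (tent0 y) ?(le_trans rd (ltW yd)) // subr0.
  have [xr|xr] := leP rho (d u x).
    by rewrite tent0 // normr0 mulr_ge0 // ltW.
  have : `|tent x| <= rho.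
    have dux := dist_ge0 dM u x.
    by rewrite /tent (max_idPr _) ?ger0_norm ?subr_ge0 ?(ltW xr) //; lra.
  move/le_trans; apply; apply: le_trans uv _; rewrite ler_pM2l //.
  by have := dist_triangle dM x u y; lra.
- move=> x xr; rewrite /F log_cutoff_eq1 ?deltaE // scale1r tent0 ?scale0r.
    by rewrite addr0 addrC subrK.
  apply: le_trans rd _; apply: le_trans xr.
  by rewrite -deltaE ler_pMr // -expR0 ler_expR invr_ge0 ltW.
- rewrite !Fu ?distxx // ?ltW // (tent0 v) // tentu scale0r addr0.
  by rewrite addrC addKr.
Qed.

(** The balls of radius [r] are disjoint, so each point meets the support of at most one [h i]. For
    a pair [x], [y] at most two terms survive, whatever [n] is. *)
Lemma disjoint_sum_lip n (h : 'I_n -> M -> V) (u : 'I_n -> M) (r L : R)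
    (s : 'I_n -> R) :
  (forall i j, i != j -> 2 * r <= d (u i) (u j)) ->
  (forall i x, r <= d (u i) x -> h i x = 0) ->
  (forall i x y, `|h i x - h i y| <= L * d x y) -> 0 <= L ->
  (forall i, `|s i| <= 1) ->
  forall x y, `|\sum_i s i *: h i x - \sum_i s i *: h i y| <= 2 * L * d x y.
Proof.
move=> usep hsupp hL L0 s1 x y.
have one z : \sum_i ((d (u i) z < r)%R : nat)%:R <= 1 :> R.
  rewrite -natr_sum lern1.
  rewrite -big_mkcond /= sum1_card; apply/card_le1_eqP => i j iz jz.
  have {}iz : d (u i) z < r := iz; have {}jz : d (u j) z < r := jz.
  apply/eqP; apply: contraT => /usep; rewrite (distC dM (u j)).
  have := dist_triangle dM z (u i) (u j); rewrite (distC dM z); lra.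
rewrite -sumrB; apply: le_trans (ler_norm_sum _ _ _) _.
apply: (@le_trans _ _ (\sum_i (L * d x y) *
    (((d (u i) x < r)%R : nat)%:R + ((d (u i) y < r)%R : nat)%:R))).
  apply: ler_sum => i _; rewrite -scalerBr normrZ.
  apply: le_trans (ler_piMl (normr_ge0 _) (s1 i)) _.
  have hi := hL i x y; have Ld : 0 <= L * d x y by rewrite mulr_ge0 ?dist_ge0.
  have [hx|hx] := ltP (d (u i) x) r; have [hy|hy] := ltP (d (u i) y) r.
  - by apply: le_trans hi _; rewrite ler_peMr // -natrD ler1n.
  - by rewrite addr0 mulr1.
  - by rewrite add0r mulr1.
  - by rewrite !(hsupp i) // subrr normr0 addr0 mulr0.
rewrite -mulr_sumr big_split /=.
have -> : 2 * L * d x y = L * d x y * 2 by ring.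
apply: ler_wpM2l; first by rewrite mulr_ge0 ?dist_ge0.
by have := one x; have := one y; lra.
Qed.

End Perturbation.

(** * The Lipschitz norm *)

Section LipNorm.
Variables (R : realType) (X : completeNormedModType R).
Variables (M : Type) (d : M -> M -> R) (x0 : M).
Hypothesis dM : is_metric d.
Implicit Types f g : M -> X.

Lemma lipnorm_le f C : 0 <= C ->
  (forall x y, `|f x - f y| <= C * d x y) -> lipnorm d f <= C.
Proof.
move=> C0 fC; rewrite /lipnorm; set S := (X in sup X).
(* If [M] is a single point, the set of slopes is empty and its [sup] is 0, which is where [0 <= C]
   enters. *)
have [->|/set0P S0] := eqVneq S set0; first by rewrite sup0.
apply: ge_sup S0 _ => _ [x [y [xy ->]]].
by rewrite ler_pdivrMr ?fC //; apply: dist_gt0.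
Qed.

Lemma lipnormP f : is_lip0 d x0 f ->
  forall x y, `|f x - f y| <= lipnorm d f * d x y.
Proof.
move=> [_ [C fC]] x y; have [->|xy] := pselect (x = y).
  by rewrite subrr normr0 distxx // mulr0.
rewrite -ler_pdivrMr ?dist_gt0 //; apply: ub_le_sup; last by exists x, y.
exists C => _ [x' [y' [xy' ->]]].
by rewrite ler_pdivrMr ?fC //; apply: dist_gt0.
Qed.

Lemma lipnorm_ge f C x y : is_lip0 d x0 f -> 0 < d x y ->
  C * d x y <= `|f x - f y| -> C <= lipnorm d f.
Proof.
move=> /lipnormP fL dxy h; rewrite -(ler_pM2r dxy).
exact: le_trans h (fL x y).
Qed.

Lemma lipnorm_ge0 f : 0 <= lipnorm d f.
Proof.
rewrite /lipnorm; set S := (X in sup X).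
(* For an arbitrary [f] the slopes may be unbounded or absent; [sup] then takes the value 0. *)
have [[[r Sr] Sub]|/sup_out->//] := pselect (has_sup S).
apply: le_trans (ub_le_sup Sub Sr); case: Sr => x [y [_ ->]].
by rewrite divr_ge0 // dist_ge0.
Qed.

Lemma lipnorm_gt0 f : is_lip0 d x0 f -> f <> (fun=> 0) -> 0 < lipnorm d f.
Proof.
move=> fL fN0; rewrite lt_neqAle lipnorm_ge0 andbT; apply/eqP => f0.
apply: fN0; apply/funext => x; apply/eqP; rewrite -normr_le0.
by have := lipnormP fL x x0; rewrite -f0 mul0r; case: fL => -> _; rewrite subr0.
Qed.

Lemma lipnorm_steep f : is_lip0 d x0 f -> 0 < lipnorm d f ->
  forall k, 0 < k -> exists x y,
    0 < d x y /\ (1 - k) * lipnorm d f * d x y < `|f x - f y|.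
Proof.
move=> fL f0 k k0; apply: contrapT => /forallNP none.
(* Without steep pairs the Lipschitz constant could be lowered; the maximum keeps it nonnegative
   when [k > 1]. *)
have : lipnorm d f <= Num.max 0 (1 - k) * lipnorm d f.
  apply: lipnorm_le => [|x y].
    by rewrite mulr_ge0 ?lipnorm_ge0 ?le_max ?lexx.
  have [->|xy] := pselect (x = y); first by rewrite subrr normr0 distxx ?mulr0.
  have dxy := dist_gt0 dM xy.
  apply: (@le_trans _ _ ((1 - k) * lipnorm d f * d x y)).
    by rewrite leNgt; apply/negP => h; apply: (none x); exists y.
  by rewrite ler_pM2r // ler_pM2r // le_max lexx orbT.
rewrite -{1}[lipnorm d f]mul1r ler_pM2r // le_max => /orP[]; lra.
Qed.

Lemma is_lip0D f g : is_lip0 d x0 f -> is_lip0 d x0 g -> is_lip0 d x0 (f \+ g).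
Proof.
move=> [f0 [C fC]] [g0 [D gD]]; split; first by rewrite /= f0 g0 addr0.
exists (C + D) => x y /=; rewrite opprD addrACA mulrDl.
by apply: le_trans (ler_normD _ _) _; rewrite lerD.
Qed.

Lemma is_lip0Z (a : R) f : is_lip0 d x0 f -> is_lip0 d x0 (fun x => a *: f x).
Proof.
move=> [f0 [C fC]]; split; first by rewrite f0 scaler0.
by exists (`|a| * C) => x y; rewrite -scalerBr normrZ -mulrA ler_wpM2l.
Qed.

Lemma is_lip0_cst0 : is_lip0 d x0 (fun=> 0 : X).
Proof. by split=> //; exists 0 => x y; rewrite subrr normr0 mul0r. Qed.

Lemma lip0_sum n (s : 'I_n -> R) (h : 'I_n -> M -> X) :
  (forall i, is_lip0 d x0 (h i)) -> is_lip0 d x0 (fun x => \sum_i s i *: h i x).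
Proof.
elim: n s h => [|n IH] s h hL.
  under [fun x => _]funext do rewrite big_ord0.
  exact: is_lip0_cst0.
under [fun x => _]funext do rewrite big_ord_recl.
by apply: is_lip0D; [exact: is_lip0Z|exact: IH].
Qed.

Lemma lipnormD_le f g : is_lip0 d x0 f -> is_lip0 d x0 g ->
  lipnorm d (f \+ g) <= lipnorm d f + lipnorm d g.
Proof.
move=> fL gL; apply: lipnorm_le => [|x y /=].
  by rewrite addr_ge0 ?lipnorm_ge0.
rewrite opprD addrACA mulrDl; apply: le_trans (ler_normD _ _) _.
by rewrite lerD // lipnormP.
Qed.

Lemma lipnormZ_le (a : R) f : is_lip0 d x0 f ->
  lipnorm d (fun x => a *: f x) <= `|a| * lipnorm d f.
Proof.
move=> fL; apply: lipnorm_le => [|x y]; first by rewrite mulr_ge0 ?lipnorm_ge0.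
by rewrite -scalerBr normrZ -mulrA ler_wpM2l // lipnormP.
Qed.

(** * Bounded operators and their norms *)

Section Operator.
Variable T : (M -> X) -> M -> X.
Hypothesis bT : lip0_bounded_op d x0 T.

Lemma op_lip0 f : is_lip0 d x0 f -> is_lip0 d x0 (T f).
Proof. by case: bT => + _ _ _; exact. Qed.

Lemma op_sum n (s : 'I_n -> R) (h : 'I_n -> M -> X) :
  (forall i, is_lip0 d x0 (h i)) ->
  T (fun x => \sum_i s i *: h i x) = fun x => \sum_i s i *: T (h i) x.
Proof.
case: bT => _ TD TZ _; elim: n s h => [|n IH] s h hL.
  (* Writing the empty sum as [0 *: 0] lets homogeneity of [T] give [T 0 = 0]. *)
  have E (k : 'I_0 -> M -> X) : (fun x => \sum_i s i *: k i x) = fun x => 0 *: 0.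
    by apply/funext => x; rewrite big_ord0 scale0r.
  by rewrite !E (TZ 0 _ is_lip0_cst0); apply/funext => x; rewrite !scale0r.
have E (k : 'I_n.+1 -> M -> X) : (fun x => \sum_i s i *: k i x) =
    (fun x => s ord0 *: k ord0 x) \+
    (fun x => \sum_(i < n) s (lift ord0 i) *: k (lift ord0 i) x).
  by apply/funext => x /=; rewrite big_ord_recl.
rewrite E TD; [|exact: is_lip0Z|exact: lip0_sum].
by rewrite TZ // IH // -E.
Qed.

Lemma op_bound : exists2 C, 0 <= C &
  forall f, is_lip0 d x0 f -> lipnorm d (T f) <= C * lipnorm d f.
Proof.
case: bT => _ _ _ [C TC]; exists `|C| => // f fL.
by apply: le_trans (TC f fL) _; rewrite ler_wpM2r ?lipnorm_ge0 // ler_norm.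
Qed.

Lemma opnorm_ge f : is_lip0 d x0 f -> lipnorm d f <= 1 ->
  lipnorm d (T f) <= lip0_opnorm d x0 T.
Proof.
move=> fL f1; apply: ub_le_sup; last by exists f.
have [C C0 TC] := op_bound; exists C => _ [g [gL g1 ->]].
by apply: le_trans (TC g gL) _; rewrite ler_piMr.
Qed.

Lemma opnorm_le C : (forall f, is_lip0 d x0 f -> lipnorm d f <= 1 ->
  lipnorm d (T f) <= C) -> lip0_opnorm d x0 T <= C.
Proof.
move=> TC; apply: ge_sup => [|_ [f [fL f1 ->]]]; last exact: TC.
exists (lipnorm d (T (fun=> 0))), (fun=> 0).
split=> //; first exact: is_lip0_cst0.
by apply: lipnorm_le => // x y; rewrite subrr normr0 mul1r dist_ge0.
Qed.

Lemma opnorm_near e : 0 < e -> exists f, [/\ is_lip0 d x0 f, lipnorm d f <= 1 &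
  lip0_opnorm d x0 T - e < lipnorm d (T f)].
Proof.
move=> e0; apply: contrapT => /forallNP none.
have : lip0_opnorm d x0 T <= lip0_opnorm d x0 T - e.
  apply: opnorm_le => f fL f1; rewrite leNgt.
  by apply/negP => h; apply: (none f).
lra.
Qed.

Lemma id_plus_bounded_op : lip0_bounded_op d x0 (fun f => f \+ T f).
Proof.
have [C C0 TC] := op_bound; case: (bT) => _ TD TZ _; split.
- by move=> f fL; apply: is_lip0D => //; exact: op_lip0.
- by move=> f g fL gL; rewrite TD //; apply/funext => x /=; rewrite addrACA.
- by move=> a f fL; rewrite TZ //; apply/funext => x /=; rewrite scalerDr.
exists (1 + C) => f fL; rewrite mulrDl mul1r.
apply: le_trans (lipnormD_le fL (op_lip0 fL)) _.
by rewrite lerD2l TC.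
Qed.

Lemma opnorm_id_plus_le :
  lip0_opnorm d x0 (fun f => f \+ T f) <= 1 + lip0_opnorm d x0 T.
Proof.
apply: ge_sup => [|_ [f [fL f1 ->]]].
  exists (lipnorm d ((fun=> 0) \+ T (fun=> 0))), (fun=> 0); split=> //.
    exact: is_lip0_cst0.
  by apply: lipnorm_le => // x y; rewrite subrr normr0 mul1r dist_ge0.
apply: le_trans (lipnormD_le fL (op_lip0 fL)) _.
by rewrite lerD // opnorm_ge.
Qed.

Lemma opnorm_gt0 f : is_lip0 d x0 f -> T f <> (fun=> 0) ->
  0 < lip0_opnorm d x0 T.
Proof.
move=> fL Tf0; case: (bT) => _ _ TZ _.
(* Scaling by [a] moves [f] into the unit ball; the added 1 keeps the denominator positive. *)
pose a := (lipnorm d f + 1)^-1.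
have a0 : 0 < a by rewrite invr_gt0 ltr_wpDl // lipnorm_ge0.
have afL : is_lip0 d x0 (fun x => a *: f x) by exact: is_lip0Z.
apply: (@lt_le_trans _ _ (lipnorm d (T (fun x => a *: f x)))).
  apply: lipnorm_gt0; first exact: op_lip0.
  rewrite TZ // => af0; apply: Tf0; apply/funext => x.
  have /eqP := congr1 (fun g => g x) af0.
  by rewrite scaler_eq0 gt_eqF //= => /eqP.
apply: opnorm_ge => //; apply: le_trans (lipnormZ_le _ fL) _.
rewrite gtr0_norm // mulrC ler_pdivrMr ?mul1r ?lerDl //.
by rewrite ltr_wpDl // lipnorm_ge0.
Qed.

(* The images are [c i *: g], and the signs of the [c i] turn the image of the
   signed sum into [(\sum_i `|c i|) *: g]. *)
Lemma rank_one_small n (h : 'I_n -> M -> X) (L C : R) (g : M -> X) :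
  (0 < n)%N ->
  (forall f, is_lip0 d x0 f -> exists c : R, T f = (fun x => c *: g x)) ->
  (forall f, is_lip0 d x0 f -> lipnorm d (T f) <= C * lipnorm d f) -> 0 <= C ->
  (forall i, is_lip0 d x0 (h i)) -> 0 <= L ->
  (forall s : 'I_n -> R, (forall i, `|s i| <= 1) ->
     forall x y, `|\sum_i s i *: h i x - \sum_i s i *: h i y| <= L * d x y) ->
  exists i, forall x y, n%:R * `|T (h i) x - T (h i) y| <= C * L * d x y.
Proof.
move=> n0 Tg TC C0 hL L0 sL.
have [c cP] := choice (fun i => Tg (h i) (hL i)).
pose i0 := Ordinal n0.
(* The index with the smallest [|c i|] satisfies [n * |c i| <= \sum_j |c j|]. *)
have [i _ iP] := @Order.TotalTheory.arg_minP _ _ _ i0 xpredT (fun j => `|c j|) isT.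
exists i => x y.
pose s j := Num.sg (c j).
have s1 j : `|s j| <= 1 by rewrite normr_sg lern1 leq_b1.
have FL := lip0_sum s hL.
have : lipnorm d (T (fun x => \sum_j s j *: h j x)) <= C * L.
  apply: le_trans (TC _ FL) _; rewrite ler_wpM2l //.
  by apply: lipnorm_le => //; exact: sL.
rewrite op_sum // => /(ler_wpM2r (dist_ge0 dM x y)); apply: le_trans.
have TFL : is_lip0 d x0 (fun x => \sum_j s j *: T (h j) x).
  by apply: lip0_sum => j; exact: op_lip0.
apply: le_trans (lipnormP TFL x y).
have sumE z : \sum_j s j *: T (h j) z = (\sum_j `|c j|) *: g z.
  rewrite scaler_suml; apply: eq_bigr => j _.
  by rewrite cP scalerA /s -normrEsg.
rewrite !sumE -scalerBr normrZ cP -scalerBr normrZ mulrA ler_wpM2r //.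
rewrite [leRHS]ger0_norm ?sumr_ge0 // mulr_natl.
rewrite -[X in _ *+ X]card_ord -sumr_const.
by apply: ler_sum => j _; exact: iP.
Qed.

End Operator.
End LipNorm.

(** * The Daugavet equation for rank-one operators *)

Section Daugavet.
Variables (R : realType) (X : completeNormedModType R).
Variables (M : Type) (d : M -> M -> R) (x0 : M).
Hypotheses (dM : is_metric d) (lM : length_space d).

(** Each [F i] modifies [f] near one of the separated steep links of [w]. The constant
    [2 * (2 + 2 * eps)] is twice the Lipschitz bound [(1 + 2 * eps) + 1] for [F i - f]. *)
Lemma local_slope_family (f w : M -> X) p eps : is_lip0 d x0 w ->
  (forall x y, `|f x - f y| <= d x y) -> 0 < lipnorm d w -> 0 < eps < 1 ->
  exists (F : 'I_(2 ^ p) -> M -> X) (u v : 'I_(2 ^ p) -> M),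
  [/\ forall i x y, `|F i x - F i y| <= (1 + 2 * eps) * d x y,
   forall i, 0 < d (u i) (v i) /\
    (1 + (1 - eps) * lipnorm d w) * d (u i) (v i) <=
      `|(F i (u i) - F i (v i)) + (w (u i) - w (v i))| &
   forall s : 'I_(2 ^ p) -> R, (forall i, `|s i| <= 1) -> forall x y,
    `|\sum_i s i *: (F i x - f x) - \sum_i s i *: (F i y - f y)| <=
      2 * (2 + 2 * eps) * d x y].
Proof.
move=> wL f1 W0 /andP[eps0 eps1].
set W := lipnorm d w in W0 *.
have eps01 : 0 < eps <= 1 by rewrite eps0 ltW.
have [r r0 rP] := steep_links dM lM W0 (lipnormP dM wL)
  (lipnorm_steep dM wL W0) p eps01.
have [rho rho0 rhoP] := local_slope_perturbation X dM r0 eps0.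
have [u [v uvP]] := rP _ rho0.
have /choice[F FP] (i : 'I_(2 ^ p)) : exists F : M -> X,
    [/\ forall x y, `|F x - F y| <= (1 + 2 * eps) * d x y,
        forall x, r <= d (u i) x -> F x = f x &
        (1 + (1 - eps) * W) * d (u i) (v i) <=
          `|(F (u i) - F (v i)) + (w (u i) - w (v i))|].
  have [/andP[uv0 uvr] wS _] := uvP i (ltn_ord i).
  set D := w (u i) - w (v i) in wS *.
  have D0 : 0 < `|D|.
    by apply: lt_le_trans wS; rewrite !mulr_gt0 // subr_gt0.
  (* The tent points along the increment [D] of [w], so that the norms of the increments of [F] and
     [w] add up exactly. *)
  have e1 : `| `|D|^-1 *: D| = 1.
    by rewrite normrZ gtr0_norm ?invr_gt0 // mulVf // gt_eqF.
  have [F [FL Ff Fuv]] := rhoP f (u i) (v i) _ f1 uvr e1.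
  exists F; split=> //.
  have DE b : b *: (`|D|^-1 *: D) + D = (b + `|D|) *: (`|D|^-1 *: D).
    by rewrite [RHS]scalerDl [`|D| *: _]scalerA mulfV ?scale1r // gt_eqF.
  rewrite Fuv DE normrZ e1 mulr1 mulrDl mul1r ger0_norm ?lerD2l //.
  by rewrite addr_ge0 // ltW.
exists F, (fun i => u i), (fun i => v i); split=> [i|i|s s1 x y].
- by case: (FP i).
- by case: (FP i) => _ _ ?; case: (uvP i (ltn_ord i)) => /andP[].
apply: (@disjoint_sum_lip _ _ _ _ dM _ (fun i x => F i x - f x)
  (fun i => u i) r) => //.
- by move=> i j ij; case: (uvP i (ltn_ord i)) => _ _; apply.
- by move=> i z rz; have [_ Ff _] := FP i; rewrite Ff // subrr.
- move=> i z t; have [FL _ _] := FP i.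
  have -> : F i z - f z - (F i t - f t) = (F i z - F i t) - (f z - f t).
    by rewrite !opprB addrACA [RHS]addrACA (addrC (- f z)).
  apply: le_trans (ler_normB _ _) _.
  by have := f1 z t; have := FL z t; lra.
- lra.
Qed.

Variable T : (M -> X) -> M -> X.
Hypothesis T1 : lip0_rank_one d x0 T.

(** The test function is a suitable [F i], shifted to vanish at [x0] and divided by [1 + 2 * eps];
    its image under [T] differs from [T f], before the division, by a map of Lipschitz constant at
    most [eps]. *)
Lemma opnorm_id_plus_ge f eps : is_lip0 d x0 f -> lipnorm d f <= 1 ->
  0 < lipnorm d (T f) -> 0 < eps < 1 ->
  1 + (1 - eps) * lipnorm d (T f) - eps <=
    (1 + 2 * eps) * lip0_opnorm d x0 (fun f => f \+ T f).
Proof.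
move=> fL f1 W0 eps01; have /andP[eps0 eps1] := eps01.
have [bT [g gP] _] := T1; have [_ TD TZ _] := bT.
have [C C0 TC] := op_bound dM bT.
set w := T f in W0 *; have wL : is_lip0 d x0 w by exact: op_lip0.
(* Since [eps < 1], the constant [2 * (2 + 2 * eps)] is below 8; with [2 ^ p] modifications the
   smallest image [T (h i)] is then [eps]-Lipschitz. *)
have [p pP] : exists p, C * 8 / eps < p%:R.
  by exists (Num.bound (C * 8 / eps)); apply: archi_boundP;
    rewrite divr_ge0 ?mulr_ge0 // ltW.
have {}pP : C * 8 <= eps * (2 ^ p)%:R.
  rewrite [leRHS]mulrC -ler_pdivrMr // (le_trans (ltW pP)) // ler_nat.
  by rewrite ltnW // ltn_expl.
have fd x y : `|f x - f y| <= d x y.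
  apply: le_trans (lipnormP dM fL x y) _.
  by rewrite ler_piMl // dist_ge0.
have [F [u [v [FL Fuv Fs]]]] := local_slope_family p wL fd W0 eps01.
(* Subtracting the value at [x0] puts [F i] into Lip_0 without changing any increment. *)
pose G i x := F i x - F i x0.
pose h i x := G i x - f x.
have GB i x y : G i x - G i y = F i x - F i y by rewrite /G opprB addrA subrK.
have GL i : is_lip0 d x0 (G i).
  by split; [rewrite /G subrr|exists (1 + 2 * eps) => x y; rewrite GB].
have hE i : h i = G i \+ (fun x => (-1) *: f x).
  by apply/funext => x; rewrite /h /= scaleN1r.
have hL i : is_lip0 d x0 (h i).
  by rewrite hE; apply: is_lip0D => //; exact: is_lip0Z.
have n0 : (0 < 2 ^ p)%N by rewrite expn_gt0.
have [||i iP] := rank_one_small dM bT n0 gP TC C0 hL (L := 2 * (2 + 2 * eps)).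
- lra.
- move=> s s1 x y.
  have E z : \sum_i s i *: h i z =
      \sum_i s i *: (F i z - f z) - \sum_i s i *: F i x0.
    rewrite -sumrB; apply: eq_bigr => i _.
    by rewrite -scalerBr /h /G addrAC.
  by rewrite !E opprB addrA subrK Fs.
have {}iP x y : `|T (h i) x - T (h i) y| <= eps * d x y.
  rewrite -(@ler_pM2l _ (2 ^ p)%:R) ?ltr0n //.
  apply: le_trans (iP x y) _; rewrite [leRHS]mulrA ler_wpM2r ?dist_ge0 //.
  rewrite [leRHS]mulrC; apply: le_trans pP; rewrite ler_wpM2l //; lra.
have TGE : T (G i) = w \+ T (h i).
  rewrite -TD //; congr (T _); apply/funext => x.
  by rewrite /= /h addrC subrK.
have [uv0 uvP] := Fuv i.
set S := lip0_opnorm _ _ _.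
pose a := (1 + 2 * eps)^-1.
have a0 : 0 < a by rewrite invr_gt0; lra.
have aGL : is_lip0 d x0 (fun x => a *: G i x) by exact: is_lip0Z.
have bIT := id_plus_bounded_op dM bT.
have : lipnorm d ((fun x => a *: G i x) \+ T (fun x => a *: G i x)) <= S.
  apply: (opnorm_ge dM bIT aGL); apply: le_trans (lipnormZ_le dM _ (GL i)) _.
  rewrite gtr0_norm // mulrC ler_pdivrMr ?mul1r; last lra.
  by apply: (lipnorm_le dM) => [|x y]; [lra|rewrite GB].
have a1 : a * (1 + 2 * eps) = 1 by rewrite /a mulVf // gt_eqF //; lra.
move=> LS; rewrite -(ler_pM2l a0) mulrA a1 mul1r; apply: le_trans LS.
apply: (lipnorm_ge dM (x0 := x0) _ uv0); first exact: (op_lip0 bIT aGL).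
rewrite /= TZ // TGE /=.
have -> : a *: G i (u i) + a *: (w (u i) + T (h i) (u i)) -
    (a *: G i (v i) + a *: (w (v i) + T (h i) (v i))) =
    a *: (((F i (u i) - F i (v i)) + (w (u i) - w (v i))) -
          (T (h i) (v i) - T (h i) (u i))).
  rewrite -!scalerDr -scalerBr -GB; congr (_ *: _).
  move: (G i (u i)) (G i (v i)) (w (u i)) (w (v i)) (T _ _) (T _ _) => *.
  by rewrite opprB opprD addrACA opprD [X in _ + X = _]addrACA [LHS]addrA.
rewrite normrZ gtr0_norm // -mulrA ler_pM2l //.
apply: le_trans (lerB_dist _ _); rewrite mulrBl lerB //.
by rewrite distrC.
Qed.

End Daugavet.

Theorem theorem1p1 (R : realType) (M : Type) (d : M -> M -> R) (x0 : M)
    (X : completeNormedModType R) :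
  is_metric d -> complete_metric d -> length_space d ->
  lip0_daugavet X d x0.
Proof.
move=> dM _ lM T T1; have [bT _ [f0 [f0L Tf0]]] := T1.
have tau0 := opnorm_gt0 dM bT f0L Tf0.
apply/le_anti; rewrite opnorm_id_plus_le //=.
set tau := lip0_opnorm d x0 T in tau0 *; set S := lip0_opnorm d x0 _.
have S0 : 0 <= S.
  have Z : is_lip0 d x0 (fun=> 0 : X) := is_lip0_cst0 _ _ _.
  apply: le_trans (opnorm_ge dM (id_plus_bounded_op dM bT) Z _).
    exact: lipnorm_ge0.
  by apply: (lipnorm_le dM) => // x y; rewrite subrr normr0 mul1r dist_ge0.
(* The error terms are [2 * e * S] from the normalization, [e * tau] from the lost slope, and [e]
   each from the choice of [f] and the perturbation of [T f]. The condition [e < tau] ensures that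
   [T f] has positive norm. *)
have key e : 0 < e -> e < 1 -> e < tau -> 1 + tau <= S + e * (2 * S + 2 + tau).
  move=> e0 e1 etau; have [f [fL f1 fW]] := opnorm_near x0 dM T e0.
  rewrite -/tau in fW.
  have W0 : 0 < lipnorm d (T f) by lra.
  have e01 : 0 < e < 1 by rewrite e0.
  have := opnorm_id_plus_ge dM lM T1 fL f1 W0 e01; rewrite -/S.
  have : lipnorm d (T f) <= tau by exact: opnorm_ge.
  by nra.
have K0 : 0 < 2 * S + 2 + tau by lra.
rewrite leNgt; apply/negP => h.
(* For [e <= m] the error in [key] is at most half of the supposed gap [1 + tau - S]. *)
pose m := (1 + tau - S) / (2 * (2 * S + 2 + tau)).
have m0 : 0 < m by apply: divr_gt0; lra.
pose e := Num.min (1 / 2) (Num.min (tau / 2) m).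
have e0 : 0 < e by rewrite !lt_min; apply/and3P; split; lra.
have e1 : e <= 1 / 2 by rewrite ge_min lexx.
have e2 : e <= tau / 2 by rewrite !ge_min lexx orbT.
have e3 : e <= m by rewrite !ge_min lexx !orbT.
have e1' : e < 1 by lra.
have e2' : e < tau by lra.
move: e3; rewrite /m ler_pdivlMr; last lra.
by have := key e e0 e1' e2'; nra.
Qed.
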